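(* Let $F\colon \mathcal{C} \to \mathcal{D}$ be a morphism of categories with denominators, and suppose that $\mathcal{D}$ is multiplicative. Then $F$ is an S-equivalence if and only if it is S-dense, S-full and S-faithful.
   Context: Conventions: every category has a set of objects and a set of morphisms (one works with Grothendieck universes). The composite of morphisms $f\colon X \to Y$ and $g\colon Y \to Z$ is written $fg\colon X \to Z$ (diagrammatic order). A functor $H\colon\mathcal{A}\to\mathcal{B}$ is an equivalence if there is a functor $K\colon\mathcal{B}\to\mathcal{A}$ with $K\circ H\cong\mathrm{id}_{\mathcal{A}}$ and $H\circ K\cong\mathrm{id}_{\mathcal{B}}$. A category with denominators is a category $\mathcal{C}$ together with an arbitrary subset of $\mathrm{Mor}\,\mathcal{C}$, whose elements are called denominators in $\mathcal{C}$. A morphism of categories with denominators $F\colon \mathcal{C} \to \mathcal{D}$ is a functor that maps denominators in $\mathcal{C}$ to denominators in $\mathcal{D}$. A category with denominators is multiplicative if its denominators are closed under composition and contain all identities. $\mathsf{GZ}(\mathcal{C})$ is the Gabriel/Zisman localisation of $\mathcal{C}$ at its denominators, with localisation functor $\mathrm{loc}\colon \mathcal{C} \to \mathsf{GZ}(\mathcal{C})$, which is the identity on objects: $\mathrm{loc}$ maps denominators to isomorphisms, and every functor $H\colon \mathcal{C}\to\mathcal{E}$ mapping denominators to isomorphisms is of the form $H = \hat H \circ \mathrm{loc}$ for a unique functor $\hat H\colon \mathsf{GZ}(\mathcal{C})\to\mathcal{E}$. For a morphism of categories with denominators $F\colon\mathcal{C} \to \mathcal{D}$, $\mathsf{GZ}(F)\colon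 \mathsf{GZ}(\mathcal{C}) \to \mathsf{GZ}(\mathcal{D})$ is the unique functor with $\mathrm{loc} \circ F = \mathsf{GZ}(F) \circ \mathrm{loc}$. $F$ is S-dense if for every object $Y$ in $\mathcal{D}$ there exist an object $X$ in $\mathcal{C}$ and a denominator $q\colon FX\to Y$ in $\mathcal{D}$. $F$ is an S-equivalence if it is S-dense and $\mathsf{GZ}(F)$ is an equivalence of categories. $F$ is S-full if for all $X, X' \in \mathrm{Ob}\,\mathcal{C}$, every morphism $g\colon FX \to \tilde Y'$ in $\mathcal{D}$ and every denominator $b\colon FX' \to \tilde Y'$ in $\mathcal{D}$, there exists a morphism $\varphi\colon X \to X'$ in $\mathsf{GZ}(\mathcal{C})$ with $\mathrm{loc}(g)\,\mathrm{loc}(b)^{-1} = \mathsf{GZ}(F)\varphi$ in $\mathsf{GZ}(\mathcal{D})$. $F$ is S-faithful if for all $X, X' \in \mathrm{Ob}\,\mathcal{C}$, every morphism $g\colon FX \to \tilde Y'$ in $\mathcal{D}$, every denominator $b\colon FX' \to \tilde Y'$ in $\mathcal{D}$ and all morphisms $\varphi_1,\varphi_2\colon X\to X'$ in $\mathsf{GZ}(\mathcal{C})$ with $\mathrm{loc}(g)\,\mathrm{loc}(b)^{-1} = \mathsf{GZ}(F)\varphi_1=\mathsf{GZ}(F)\varphi_2$ in $\mathsf{GZ}(\mathcal{D})$, one has $\varphi_1=\varphi_2$. *)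

(* Defs.v *)
From Stdlib Require Import FunctionalExtensionality PropExtensionality.
From Stdlib Require Import ProofIrrelevance IndefiniteDescription.

Set Implicit Arguments.
Unset Strict Implicit.
Unset Printing Implicit Defensive.

(* Composition is written in diagrammatic order:
   for f : X -> Y and g : Y -> Z, the composite is f ;; g : X -> Z. *)
Reserved Notation "f ;; g" (at level 40, left associativity).

Record Category : Type := MkCategory {
  obj :> Type;
  hom : obj -> obj -> Type;
  idm : forall X, hom X X;
  comp : forall X Y Z, hom X Y -> hom Y Z -> hom X Z;
  comp_id_l : forall X Y (f : hom X Y), comp (idm X) f = f;
  comp_id_r : forall X Y (f : hom X Y), comp f (idm Y) = f;
  comp_assoc : forall W X Y Z (f : hom W X) (g : hom X Y) (h : hom Y Z),
    comp (comp f g) h = comp f (comp g h) }.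

Arguments hom {c} X Y.
Arguments idm {c} X.
Arguments comp {c X Y Z} f g.
Notation "f ;; g" := (comp f g).

Record Functor (A B : Category) : Type := MkFunctor {
  fobj :> A -> B;
  fmap : forall X Y : A, hom X Y -> hom (fobj X) (fobj Y);
  fmap_id : forall X : A, fmap (idm X) = idm (fobj X);
  fmap_comp : forall (X Y Z : A) (f : hom X Y) (g : hom Y Z),
    fmap (f ;; g) = fmap f ;; fmap g }.

Arguments fmap {A B} _ {X Y} _.
Arguments fmap_id {A B} _ X.
Arguments fmap_comp {A B} _ {X Y Z} _ _.

Definition functor_id (A : Category) : Functor A A :=
  @MkFunctor A A (fun X => X) (fun _ _ f => f)
    (fun _ => eq_refl) (fun _ _ _ _ _ => eq_refl).

(* First F, then G: this is the functor usually written G o F. *)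
Definition functor_comp (A B C : Category) (F : Functor A B) (G : Functor B C) :
  Functor A C.
Proof.
  refine (@MkFunctor A C (fun X => G (F X)) (fun _ _ f => fmap G (fmap F f)) _ _).
  - intros X. now rewrite !fmap_id.
  - intros X Y Z f g. now rewrite !fmap_comp.
Defined.

Definition inverse_pair (A : Category) (X Y : A) (f : hom X Y) (g : hom Y X) : Prop :=
  f ;; g = idm X /\ g ;; f = idm Y.

Definition is_iso (A : Category) (X Y : A) (f : hom X Y) : Prop :=
  exists g : hom Y X, inverse_pair f g.

Definition iso_inv (A : Category) (X Y : A) (f : hom X Y) (Hf : is_iso f) : hom Y X :=
  proj1_sig (constructive_indefinite_description _ Hf).

Lemma iso_invP (A : Category) (X Y : A) (f : hom X Y) (Hf : is_iso f) :
  inverse_pair f (iso_inv Hf).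
Proof. exact (proj2_sig (constructive_indefinite_description _ Hf)). Qed.

Lemma inverse_unique (A : Category) (X Y : A) (f : hom X Y) (g h : hom Y X) :
  inverse_pair f g -> inverse_pair f h -> g = h.
Proof.
  intros [_ Hg] [Hh _].
  now rewrite <- (comp_id_r g), <- Hh, <- comp_assoc, Hg, comp_id_l.
Qed.

Definition functors_isomorphic (A B : Category) (F G : Functor A B) : Prop :=
  exists eta : forall X : A, hom (F X) (G X),
    (forall (X Y : A) (f : hom X Y), fmap F f ;; eta Y = eta X ;; fmap G f) /\
    (forall X : A, is_iso (eta X)).

Definition is_equivalence (A B : Category) (H : Functor A B) : Prop :=
  exists K : Functor B A,
    functors_isomorphic (functor_comp H K) (functor_id A) /\
    functors_isomorphic (functor_comp K H) (functor_id B).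

Record DenCategory : Type := MkDenCategory {
  den_cat :> Category;
  den : forall X Y : den_cat, hom X Y -> Prop }.

Arguments den {d X Y} _.

Record DenFunctor (C D : DenCategory) : Type := MkDenFunctor {
  den_functor :> Functor C D;
  fmap_den : forall (X Y : C) (d : hom X Y), den d -> den (fmap den_functor d) }.

Definition multiplicative (C : DenCategory) : Prop :=
  (forall (X Y Z : C) (d : hom X Y) (e : hom Y Z), den d -> den e -> den (d ;; e)) /\
  (forall X : C, den (idm X)).

Definition inverts_den (C : DenCategory) (E : Category) (H : Functor C E) : Prop :=
  forall (X Y : C) (d : hom X Y), den d -> is_iso (fmap H d).

Section Localisation.

Variable C : DenCategory.

(* GZ(C) has the objects of C; its morphisms are formal composites of morphisms
   of C and of formal inverses of denominators, modulo the congruence generated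
   by the category axioms, functoriality of [wloc], and invertibility of the
   denominators.  [gz_universal] below is its universal property. *)
Inductive word : C -> C -> Type :=
| wloc : forall X Y (f : hom X Y), word X Y
| winv : forall X Y (d : hom X Y), den d -> word Y X
| wcomp : forall X Y Z, word X Y -> word Y Z -> word X Z.

Inductive weq : forall X Y : C, word X Y -> word X Y -> Prop :=
| weq_refl : forall X Y (u : word X Y), weq u u
| weq_sym : forall X Y (u v : word X Y), weq u v -> weq v u
| weq_trans : forall X Y (u v w : word X Y), weq u v -> weq v w -> weq u w
| weq_wcomp : forall X Y Z (u u' : word X Y) (v v' : word Y Z),
    weq u u' -> weq v v' -> weq (wcomp u v) (wcomp u' v')
| weq_assoc : forall W X Y Z (u : word W X) (v : word X Y) (w : word Y Z),
    weq (wcomp (wcomp u v) w) (wcomp u (wcomp v w))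
| weq_id_l : forall X Y (u : word X Y), weq (wcomp (wloc (idm X)) u) u
| weq_id_r : forall X Y (u : word X Y), weq (wcomp u (wloc (idm Y))) u
| weq_comp : forall X Y Z (f : hom X Y) (g : hom Y Z),
    weq (wloc (f ;; g)) (wcomp (wloc f) (wloc g))
| weq_inv_r : forall X Y (d : hom X Y) (Hd : den d),
    weq (wcomp (wloc d) (winv Hd)) (wloc (idm X))
| weq_inv_l : forall X Y (d : hom X Y) (Hd : den d),
    weq (wcomp (winv Hd) (wloc d)) (wloc (idm Y)).

Definition gz_hom (X Y : C) : Type :=
  { P : word X Y -> Prop | exists w, P = weq w }.

Definition gz_class (X Y : C) (w : word X Y) : gz_hom X Y :=
  exist _ (weq w) (ex_intro _ w eq_refl).

Lemma gz_class_eq (X Y : C) (u v : word X Y) :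
  gz_class u = gz_class v <-> weq u v.
Proof.
  split; intros H.
  - apply (f_equal (@proj1_sig _ _)) in H; cbn in H.
    rewrite H. apply weq_refl.
  - unfold gz_class. apply subset_eq_compat.
    apply functional_extensionality; intros w.
    apply propositional_extensionality; split; intros K.
    + exact (weq_trans (weq_sym H) K).
    + exact (weq_trans H K).
Qed.

Lemma gz_class_surj (X Y : C) (a : gz_hom X Y) : exists w, gz_class w = a.
Proof.
  destruct a as [P [w Hw]]. exists w.
  apply subset_eq_compat. now symmetry.
Qed.

Definition gz_rep (X Y : C) (a : gz_hom X Y) : word X Y :=
  proj1_sig (constructive_indefinite_description _ (gz_class_surj a)).

Lemma gz_repK (X Y : C) (a : gz_hom X Y) : gz_class (gz_rep a) = a.
Proof. exact (proj2_sig (constructive_indefinite_description _ (gz_class_surj a))). Qed.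

Lemma gz_rep_class (X Y : C) (w : word X Y) : weq (gz_rep (gz_class w)) w.
Proof. apply gz_class_eq, gz_repK. Qed.

Definition gz_comp (X Y Z : C) (a : gz_hom X Y) (b : gz_hom Y Z) : gz_hom X Z :=
  gz_class (wcomp (gz_rep a) (gz_rep b)).

Lemma gz_comp_class (X Y Z : C) (u : word X Y) (v : word Y Z) :
  gz_comp (gz_class u) (gz_class v) = gz_class (wcomp u v).
Proof. apply gz_class_eq, weq_wcomp; apply gz_rep_class. Qed.

Definition GZ : Category.
Proof.
  refine (@MkCategory C gz_hom (fun X => gz_class (wloc (idm X))) gz_comp _ _ _).
  - intros X Y a. destruct (gz_class_surj a) as [u <-].
    rewrite gz_comp_class. apply gz_class_eq, weq_id_l.
  - intros X Y a. destruct (gz_class_surj a) as [u <-].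
    rewrite gz_comp_class. apply gz_class_eq, weq_id_r.
  - intros W X Y Z a b c.
    destruct (gz_class_surj a) as [u <-], (gz_class_surj b) as [v <-],
      (gz_class_surj c) as [w <-].
    rewrite !gz_comp_class. apply gz_class_eq, weq_assoc.
Defined.

Definition loc : Functor C GZ.
Proof.
  refine (@MkFunctor C GZ (fun X => X) (fun X Y f => gz_class (wloc f)) _ _).
  - reflexivity.
  - intros X Y Z f g. cbn. rewrite gz_comp_class. apply gz_class_eq, weq_comp.
Defined.

Lemma loc_den : inverts_den loc.
Proof.
  intros X Y d Hd. exists (gz_class (winv Hd)). split; cbn;
    rewrite gz_comp_class; apply gz_class_eq.
  - apply weq_inv_r.
  - apply weq_inv_l.
Qed.

Section Lift.

Variables (E : Category) (H : Functor C E) (Hden : inverts_den H).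

Fixpoint word_eval (X Y : C) (w : word X Y) : hom (H X) (H Y) :=
  match w in word X Y return hom (H X) (H Y) with
  | wloc f => fmap H f
  | winv Hd => iso_inv (Hden Hd)
  | wcomp u v => word_eval u ;; word_eval v
  end.

Lemma word_eval_weq (X Y : C) (u v : word X Y) :
  weq u v -> word_eval u = word_eval v.
Proof.
  induction 1; cbn; try congruence.
  - apply comp_assoc.
  - now rewrite fmap_id, comp_id_l.
  - now rewrite fmap_id, comp_id_r.
  - apply fmap_comp.
  - rewrite fmap_id. apply (iso_invP (Hden Hd)).
  - rewrite fmap_id. apply (iso_invP (Hden Hd)).
Qed.

Lemma word_eval_rep (X Y : C) (w : word X Y) :
  word_eval (gz_rep (gz_class w)) = word_eval w.
Proof. apply word_eval_weq, gz_rep_class. Qed.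

Definition gz_lift : Functor GZ E.
Proof.
  refine (@MkFunctor GZ E (fun X => H X) (fun X Y a => word_eval (gz_rep a)) _ _).
  - intros X. cbn. rewrite word_eval_rep. apply fmap_id.
  - intros X Y Z a b. cbn. unfold gz_comp. now rewrite word_eval_rep.
Defined.

End Lift.

Lemma functor_eq (A B : Category) (o : A -> B)
  (m m' : forall X Y : A, hom X Y -> hom (o X) (o Y)) i i' c c' :
  (forall X Y f, m X Y f = m' X Y f) ->
  @MkFunctor A B o m i c = @MkFunctor A B o m' i' c'.
Proof.
  intros Hm.
  assert (m = m') as <-.
  { apply functional_extensionality_dep; intros X.
    apply functional_extensionality_dep; intros Y.
    apply functional_extensionality; intros f. apply Hm. }
  f_equal; apply proof_irrelevance.
Qed.

Lemma loc_gz_lift (E : Category) (H : Functor C E) (Hden : inverts_den H) :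
  functor_comp loc (gz_lift Hden) = H.
Proof.
  destruct H as [o m i c]. unfold functor_comp. cbn.
  apply functor_eq. intros X Y f. exact (word_eval_rep Hden (wloc f)).
Qed.

Lemma gz_lift_unique (E : Category) (H : Functor C E) (Hden : inverts_den H)
  (K : Functor GZ E) : functor_comp loc K = H -> gz_lift Hden = K.
Proof.
  intros <-. destruct K as [o m i c]. unfold gz_lift.
  apply functor_eq. intros X Y a.
  rewrite <- (gz_repK a) at 2. generalize (gz_rep a) as w. clear a.
  induction w as [X Y f | X Y d Hd | X Y Z u IHu v IHv]; cbn in *.
  - reflexivity.
  - apply (inverse_unique (iso_invP (Hden _ _ d Hd))). cbn.
    split; rewrite <- c, <- i; f_equal; cbn; rewrite gz_comp_class;
      apply gz_class_eq.
    + apply weq_inv_r.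
    + apply weq_inv_l.
  - rewrite IHu, IHv, <- c. cbn. now rewrite gz_comp_class.
Qed.

Theorem gz_universal (E : Category) (H : Functor C E) :
  inverts_den H -> exists! K : Functor GZ E, functor_comp loc K = H.
Proof.
  intros Hden. exists (gz_lift Hden). split.
  - apply loc_gz_lift.
  - intros K. apply gz_lift_unique.
Qed.

End Localisation.

Arguments loc {C}.
Arguments loc_den {C X Y d} _.

Lemma comp_loc_inverts_den (C D : DenCategory) (F : DenFunctor C D) :
  inverts_den (functor_comp F (@loc D)).
Proof. intros X Y d Hd. exact (loc_den (fmap_den F Hd)). Qed.

Definition GZmap (C D : DenCategory) (F : DenFunctor C D) : Functor (GZ C) (GZ D) :=
  gz_lift (comp_loc_inverts_den F).

Theorem GZmap_spec (C D : DenCategory) (F : DenFunctor C D) :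
  unique (fun K : Functor (GZ C) (GZ D) => functor_comp F loc = functor_comp loc K)
    (GZmap F).
Proof.
  split.
  - symmetry. apply loc_gz_lift.
  - intros K HK. apply gz_lift_unique. now symmetry.
Qed.

Definition loc_inv (C : DenCategory) (X Y : C) (b : hom X Y) (Hb : den b) :
  @hom (GZ C) Y X := iso_inv (loc_den Hb).

Definition S_dense (C D : DenCategory) (F : DenFunctor C D) : Prop :=
  forall Y : D, exists (X : C) (q : hom (F X) Y), den q.

Definition S_equivalence (C D : DenCategory) (F : DenFunctor C D) : Prop :=
  S_dense F /\ is_equivalence (GZmap F).

Definition S_full (C D : DenCategory) (F : DenFunctor C D) : Prop :=
  forall (X X' : C) (Y' : D) (g : hom (F X) Y') (b : hom (F X') Y') (Hb : den b),
  exists phi : @hom (GZ C) X X',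
    fmap loc g ;; loc_inv Hb = fmap (GZmap F) phi.

Definition S_faithful (C D : DenCategory) (F : DenFunctor C D) : Prop :=
  forall (X X' : C) (Y' : D) (g : hom (F X) Y') (b : hom (F X') Y') (Hb : den b)
    (phi1 phi2 : @hom (GZ C) X X'),
    fmap loc g ;; loc_inv Hb = fmap (GZmap F) phi1 ->
    fmap loc g ;; loc_inv Hb = fmap (GZmap F) phi2 ->
    phi1 = phi2.

(* Main.v *)
(** The S-hypotheses speak only about fractions [loc(g) loc(b)^-1].  Choose for
   every object [Y] of [D] a denominator [q Y : F (s Y) -> Y].  Conjugation by
   the [q Y] turns morphisms of [D], and, as [D] is multiplicative, also inverses
   of denominators, into fractions between objects in the image of [F].
   Lifting these fractions uniquely along [GZ(F)] yields a functor [D -> GZ(C)]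
   that inverts denominators, hence a functor [GZ(D) -> GZ(C)].  It is
   inverse to [GZ(F)] up to isomorphism because naturality has to be tested on
   the image of [loc] only, where everything in sight is again a fraction. *)
From Stdlib Require Import IndefiniteDescription.
Require Import Defs.

Set Implicit Arguments.
Unset Strict Implicit.
Unset Printing Implicit Defensive.

Lemma iso_cancel_r (A : Category) (X Y Z : A) (f g : hom X Y) (h : hom Y Z) :
  is_iso h -> f ;; h = g ;; h -> f = g.
Proof.
  intros [k [Hk _]] E.
  now rewrite <- (comp_id_r f), <- (comp_id_r g), <- Hk, <- !comp_assoc, E.
Qed.

Lemma iso_cancel_l (A : Category) (X Y Z : A) (f g : hom Y Z) (h : hom X Y) :
  is_iso h -> h ;; f = h ;; g -> f = g.
Proof.
  intros [k [_ Hk]] E.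
  now rewrite <- (comp_id_l f), <- (comp_id_l g), <- Hk, !comp_assoc, E.
Qed.

Definition faithful (A B : Category) (H : Functor A B) : Prop :=
  forall (X Y : A) (f g : hom X Y), fmap H f = fmap H g -> f = g.

Definition full (A B : Category) (H : Functor A B) : Prop :=
  forall (X Y : A) (g : hom (H X) (H Y)), exists f : hom X Y, fmap H f = g.

(** Conjugation by [eta] recovers [f] from [K (H f)]. *)
Lemma faithful_of_retraction (A B : Category) (H : Functor A B) (K : Functor B A) :
  functors_isomorphic (functor_comp H K) (functor_id A) -> faithful H.
Proof.
  intros [eta [nat iso]] X Y f g E.
  apply (iso_cancel_l (iso X)).
  change (eta X ;; fmap (functor_id A) f = eta X ;; fmap (functor_id A) g).
  rewrite <- !nat. cbn. now rewrite E.
Qed.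

Lemma equivalence_faithful (A B : Category) (H : Functor A B) :
  is_equivalence H -> faithful H.
Proof. intros [K [HK _]]. exact (faithful_of_retraction HK). Qed.

Lemma equivalence_full (A B : Category) (H : Functor A B) :
  is_equivalence H -> full H.
Proof.
  intros [K [[eta [nat iso]] KH]] X Y g.
  destruct (iso X) as [theta [Ht _]].
  (* This is [K g] conjugated by [eta]. As [K] is faithful too, [fmap H f = g] may be tested after
     applying [K], where it is naturality of [eta]. *)
  exists (theta ;; fmap K g ;; eta Y).
  apply (faithful_of_retraction KH), (iso_cancel_r (iso Y)).
  etransitivity; [apply nat|]. cbn in *.
  now rewrite <- !comp_assoc, Ht, comp_id_l.
Qed.

(** Morphisms of [GZ C] are composites of images under [loc] and their formal inverses; naturality
    squares can be pasted, and a square at a denominator can be reversed. *)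
Lemma gz_natural (C : DenCategory) (E : Category) (G H : Functor (GZ C) E)
  (eta : forall X : C, hom (G X) (H X)) :
  (forall (X Y : C) (f : hom X Y),
     fmap G (fmap loc f) ;; eta Y = eta X ;; fmap H (fmap loc f)) ->
  forall (X Y : GZ C) (a : hom X Y), fmap G a ;; eta Y = eta X ;; fmap H a.
Proof.
  intros nat X Y a. destruct (gz_class_surj a) as [w <-].
  induction w as [X Y f | X Y d Hd | X Y Z u IHu v IHv].
  - apply nat.
  - destruct (iso_invP (loc_den Hd)) as [E1 E2].
    assert (gz_class (winv Hd) = iso_inv (loc_den Hd)) as ->.
    { apply (@inverse_unique (GZ C) X Y (fmap loc d)); [|apply iso_invP].
      split; cbn; rewrite gz_comp_class; apply gz_class_eq;
        [apply weq_inv_r | apply weq_inv_l]. }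
    pose proof (f_equal (fun a => fmap G a) E2) as G2.
    pose proof (f_equal (fun a => fmap H a) E1) as H1.
    rewrite fmap_comp, fmap_id in G2, H1.
    change (fmap G (iso_inv (loc_den Hd)) ;; eta X
      = eta Y ;; fmap H (iso_inv (loc_den Hd))).
    rewrite <- (comp_id_r (eta X)).
    transitivity (fmap G (iso_inv (loc_den Hd)) ;;
      (eta X ;; (fmap H (fmap loc d) ;; fmap H (iso_inv (loc_den Hd))))).
    { now rewrite H1. }
    rewrite <- (comp_assoc (eta X)), <- nat, <- !comp_assoc, G2.
    now rewrite comp_id_l.
  - rewrite <- gz_comp_class.
    change (gz_comp (gz_class u) (gz_class v))
      with (@comp (GZ C) X Y Z (gz_class u) (gz_class v)).
    now rewrite !fmap_comp, comp_assoc, IHv, <- !comp_assoc, IHu.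
Qed.

(* [loc] and [GZmap F] with the objects of their values already reduced, so that
   composites of the two match syntactically. *)
Definition locm (D : DenCategory) (X Y : D) (f : hom X Y) : @hom (GZ D) X Y :=
  fmap loc f.

Definition gzm (C D : DenCategory) (F : DenFunctor C D) (X Y : C)
  (phi : @hom (GZ C) X Y) : @hom (GZ D) (F X) (F Y) := fmap (GZmap F) phi.

Lemma locm_comp (D : DenCategory) (X Y Z : D) (f : hom X Y) (g : hom Y Z) :
  locm (f ;; g) = locm f ;; locm g.
Proof. exact (fmap_comp loc f g). Qed.

Lemma gzm_id (C D : DenCategory) (F : DenFunctor C D) (X : C) :
  gzm F (idm (X : GZ C)) = idm (F X : GZ D).
Proof. exact (fmap_id (GZmap F) X). Qed.

Lemma gzm_comp (C D : DenCategory) (F : DenFunctor C D) (X Y Z : C)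
  (phi : @hom (GZ C) X Y) (psi : @hom (GZ C) Y Z) :
  gzm F (phi ;; psi) = gzm F phi ;; gzm F psi.
Proof. exact (fmap_comp (GZmap F) phi psi). Qed.

Lemma gzm_locm (C D : DenCategory) (F : DenFunctor C D) (X Y : C) (f : hom X Y) :
  gzm F (locm f) = locm (fmap F f).
Proof. exact (word_eval_rep (comp_loc_inverts_den F) (wloc f)). Qed.

(** Clearing the denominator: from here on, fractions are compared by equations free of inverses. *)
Lemma fraction_eq (D : DenCategory) (Y Y' Z : D) (a : @hom (GZ D) Y Y')
  (g : hom Y Z) (b : hom Y' Z) (Hb : den b) :
  locm g ;; loc_inv Hb = a <-> a ;; locm b = locm g.
Proof.
  destruct (iso_invP (loc_den Hb) :
    @inverse_pair (GZ D) Y' Z (locm b) (loc_inv Hb)) as [E1 E2].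
  split; [intros <- | intros <-]; rewrite comp_assoc, ?E1, ?E2; apply comp_id_r.
Qed.

Lemma S_full_lift (C D : DenCategory) (F : DenFunctor C D) :
  S_full F -> forall (X X' : C) (Z : D) (g : hom (F X) Z) (b : hom (F X') Z),
  den b -> exists phi : @hom (GZ C) X X', gzm F phi ;; locm b = locm g.
Proof.
  intros HF X X' Z g b Hb. destruct (HF X X' Z g b Hb) as [phi E].
  exists phi. exact (proj1 (fraction_eq _ _ Hb) E).
Qed.

Lemma S_faithful_lift (C D : DenCategory) (F : DenFunctor C D) :
  S_faithful F -> forall (X X' : C) (Z : D) (g : hom (F X) Z) (b : hom (F X') Z)
    (phi1 phi2 : @hom (GZ C) X X'),
  den b -> gzm F phi1 ;; locm b = locm g -> gzm F phi2 ;; locm b = locm g ->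
  phi1 = phi2.
Proof.
  intros HF X X' Z g b phi1 phi2 Hb E1 E2.
  apply (HF X X' Z g b Hb); now apply (fraction_eq _ _ Hb).
Qed.

Lemma S_dense_choice (C D : DenCategory) (F : DenFunctor C D) :
  S_dense F -> exists (s : D -> C) (q : forall Y, hom (F (s Y)) Y),
    forall Y, den (q Y).
Proof.
  intros HF.
  destruct (functional_choice _ HF) as [s Hs].
  exists s, (fun Y => proj1_sig (constructive_indefinite_description _ (Hs Y))).
  intros Y. exact (proj2_sig (constructive_indefinite_description _ (Hs Y))).
Qed.

Lemma S_conditions_equivalence (C D : DenCategory) (F : DenFunctor C D) :
  multiplicative D -> S_dense F -> S_full F -> S_faithful F ->
  is_equivalence (GZmap F).
Proof.
  intros [den_comp den_id] Hdense Hfull Hfaithful.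
  destruct (S_dense_choice Hdense) as (s & q & Hq).
  pose proof (S_full_lift Hfull) as lift.
  pose proof (S_faithful_lift Hfaithful) as uniq.
  (* [m Y Y' f] lifts the conjugate of [locm f] by [q], that is, the fraction with numerator
     [q Y ;; f] and denominator [q Y']. Functoriality follows from uniqueness of lifts. *)
  pose (m Y Y' (f : hom Y Y') := proj1_sig (constructive_indefinite_description _
    (lift _ _ _ (q Y ;; f) (q Y') (Hq Y')))).
  assert (Hm : forall Y Y' (f : hom Y Y'),
    gzm F (m _ _ f) ;; locm (q Y') = locm (q Y ;; f)).
  { intros Y Y' f. exact (proj2_sig (constructive_indefinite_description _
      (lift _ _ _ (q Y ;; f) (q Y') (Hq Y')))). }
  clearbody m.
  assert (m_id : forall Y, m _ _ (idm Y) = idm (s Y : GZ C)).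
  { intros Y. apply (uniq _ _ _ _ _ _ _ (Hq Y) (Hm _ _ _)).
    rewrite gzm_id, comp_id_r. apply comp_id_l. }
  assert (m_comp : forall X Y Z (f : hom X Y) (g : hom Y Z),
    m _ _ (f ;; g) = m _ _ f ;; m _ _ g).
  { intros X Y Z f g. apply (uniq _ _ _ _ _ _ _ (Hq Z) (Hm _ _ _)).
    rewrite gzm_comp, comp_assoc, Hm, locm_comp, <- comp_assoc, Hm.
    now rewrite <- locm_comp, comp_assoc. }
  pose (K := @MkFunctor D (GZ C) s m m_id m_comp).
  assert (HK : inverts_den K).
  { intros Y Y' d Hd.
    (* Closure under composition makes [q Y ;; d] a denominator, so the conjugate of the inverse of
       [locm d] is again a fraction; its lift [n] inverts [m _ _ d]. *)
    pose proof (den_comp _ _ _ _ _ (Hq Y) Hd) as Hqd.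
    destruct (lift _ _ _ (q Y') _ Hqd) as [n Hn].
    exists n. split.
    - change (m _ _ d ;; n = idm (s Y : GZ C)).
      apply (uniq _ _ _ (q Y ;; d) _ _ _ Hqd).
      + rewrite gzm_comp, comp_assoc, Hn. apply Hm.
      + rewrite gzm_id. apply comp_id_l.
    - change (n ;; m _ _ d = idm (s Y' : GZ C)).
      apply (uniq _ _ _ (q Y') _ _ _ (Hq Y')).
      + rewrite gzm_comp, comp_assoc, Hm. apply Hn.
      + rewrite gzm_id. apply comp_id_l. }
  assert (HKloc : forall Y Y' (f : hom Y Y'),
    fmap (gz_lift HK) (locm f) = m _ _ f).
  { intros Y Y' f. exact (word_eval_rep HK (wloc f)). }
  exists (gz_lift HK). split.
  (* [e X] lifts [locm (q (F X))], viewed as a fraction with identity denominator. *)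
  - pose (e X := proj1_sig (constructive_indefinite_description _
      (lift _ _ _ (q (F X)) (idm (F X)) (den_id _)))).
    assert (He : forall X, gzm F (e X) ;; locm (idm (F X)) = locm (q (F X))).
    { intros X. exact (proj2_sig (constructive_indefinite_description _
        (lift _ _ _ (q (F X)) (idm (F X)) (den_id _)))). }
    clearbody e.
    exists e. split.
    + apply gz_natural. intros X Y f.
      change (fmap (gz_lift HK) (gzm F (locm f)) ;; e Y = e X ;; locm f).
      rewrite gzm_locm, HKloc.
      (* Both ways around the square lift [locm (q (F X) ;; fmap F f)]. *)
      apply (uniq _ _ _ (q (F X) ;; fmap F f) _ _ _ (den_id _)).
      * rewrite gzm_comp, comp_assoc, He. apply Hm.
      * rewrite gzm_comp, gzm_locm, comp_assoc, <- locm_comp, comp_id_r.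
        rewrite <- (comp_id_l (fmap F f)), locm_comp, <- comp_assoc, He.
        now rewrite <- locm_comp, comp_id_l.
    + intros X.
      (* [t] lifts the inverse of [locm (q (F X))]. *)
      destruct (lift _ _ _ (idm (F X)) _ (Hq (F X))) as [t Ht].
      exists t. split.
      * change (e X ;; t = idm (s (F X) : GZ C)).
        apply (uniq _ _ _ (q (F X)) _ _ _ (Hq (F X))).
        -- rewrite gzm_comp, comp_assoc, Ht. apply He.
        -- rewrite gzm_id. apply comp_id_l.
      * change (t ;; e X = idm (X : GZ C)).
        apply (uniq _ _ _ (idm (F X)) _ _ _ (den_id _)).
        -- rewrite gzm_comp, comp_assoc, He. apply Ht.
        -- rewrite gzm_id. apply comp_id_l.
  (* For the other composite, naturality of [q] on the image of [loc] is the defining equation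
     [Hm]. *)
  - exists (fun Y => locm (q Y)). split.
    + apply gz_natural. intros Y Y' f.
      change (gzm F (fmap (gz_lift HK) (locm f)) ;; locm (q Y') = locm (q Y) ;; locm f).
      rewrite HKloc, <- locm_comp. apply Hm.
    + intros Y. exact (loc_den (Hq Y)).
Qed.

Theorem corollary5p25 (C D : DenCategory) (F : DenFunctor C D)
  (hD : multiplicative D) :
  S_equivalence F <-> S_dense F /\ S_full F /\ S_faithful F.
Proof.
  split.
  - intros [Hdense Heq]. split; [exact Hdense|split].
    + intros X X' Y' g b Hb.
      destruct (equivalence_full Heq (X := X) (Y := X') (fmap loc g ;; loc_inv Hb))
        as [phi E].
      now exists phi.
    + intros X X' Y' g b Hb phi1 phi2 E1 E2.
      apply (equivalence_faithful Heq). now rewrite <- E1.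
  - intros (Hdense & Hfull & Hfaithful). split; [exact Hdense|].
    now apply S_conditions_equivalence.
Qed.
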